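(* Adding an edge between two distinct, nonadjacent vertices of a connected graph can decrease the density by an amount arbitrarily close to $1/3$. That is, for every $\varepsilon>0$ there exist a connected graph $G$ and two distinct, nonadjacent vertices $u,v$ of $G$ such that, writing $H$ for the graph obtained from $G$ by adding the edge $uv$, $$\left|\big(\mathrm{Den}(G)-\mathrm{Den}(H)\big)-\tfrac13\right|<\varepsilon .$$
   Context: Graphs are finite, loopless, and have no multiple edges. A subtree of a graph $G$ is a (not necessarily induced) subgraph of $G$ that is a tree; the null graph (with no vertices) is not counted as a subtree, while single vertices are. Let $\mathcal{T}_G$ be the set of subtrees of $G$. The subtree polynomial of $G$ is $S_G(x)=\sum_{T\in\mathcal{T}_G}x^{|V(T)|}$. The mean subtree order of $G$ is the average order (number of vertices) of a subtree of $G$, that is, $\mu(G)=S_G'(1)/S_G(1)$. If $G$ has order $n$ (i.e., $n$ vertices), the density of $G$ is $\mathrm{Den}(G)=\mu(G)/n$. *)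

(* Defs.v *)
From HB Require Import structures.
From mathcomp Require Import all_boot all_order all_algebra.
From mathcomp Require Import reals.

Set Implicit Arguments.
Unset Strict Implicit.
Unset Printing Implicit Defensive.

Import Order.TTheory GRing.Theory Num.Theory.

Record sgraph := SGraph {
  vertex :> finType;
  adj : rel vertex;
  adj_sym : symmetric adj;
  adj_irrefl : irreflexive adj }.

Definition edges (G : sgraph) : {set {set G}} :=
  [set [set p.1; p.2] | p in [set p : G * G | adj p.1 p.2]].

(* The null graph is not connected. *)
Definition connected_on (T : finType) (V : {set T}) (e : rel T) : bool :=
  (V != set0) && [forall x in V, forall y in V, connect e x y].

Definition connected (G : sgraph) : bool :=
  connected_on [set: G] (@adj G).

(* [cycle e c] alone also holds of a single edge traversed back and forth, hence
   the bound [2 < k]; a duplicate-free sequence has length at most [#|T|]. *)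
Definition acyclic (T : finType) (e : rel T) : bool :=
  ~~ [exists k : 'I_#|T|.+1, exists c : k.-tuple T,
        [&& 2 < k, uniq c & cycle e c]].

(* A subgraph, not necessarily induced, is encoded as a pair: its vertex set and
   its set of edges (two-element sets of vertices). *)
Definition subgraph (G : sgraph) (S : {set G} * {set {set G}}) : bool :=
  (S.2 \subset edges G) && (cover S.2 \subset S.1).

Definition edge_rel (T : finType) (E : {set {set T}}) : rel T :=
  [rel x y | [set x; y] \in E].

Definition is_tree (T : finType) (S : {set T} * {set {set T}}) : bool :=
  connected_on S.1 (edge_rel S.2) && acyclic (edge_rel S.2).

Definition subtrees (G : sgraph) : {set {set G} * {set {set G}}} :=
  [set S | subgraph S && is_tree S].

Local Open Scope ring_scope.

Definition subtree_poly (R : realType) (G : sgraph) : {poly R} :=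
  \sum_(S in subtrees G) 'X^#|S.1|.

Definition mean_subtree_order (R : realType) (G : sgraph) : R :=
  (subtree_poly R G)^`().[1] / (subtree_poly R G).[1].

Definition density (R : realType) (G : sgraph) : R :=
  mean_subtree_order R G / #|G|%:R.

Section AddEdge.
Variables (G : sgraph) (u v : G).

(* The conjunct [x != y] only matters when [u = v], where no edge is added. *)
Definition add_edge_rel : rel G :=
  [rel x y | adj x y || (x != y) && ([set x; y] == [set u; v])].

Lemma add_edge_sym : symmetric add_edge_rel.
Proof. by move=> x y; rewrite /add_edge_rel /= adj_sym eq_sym [[set x; y]]setUC. Qed.

Lemma add_edge_irrefl : irreflexive add_edge_rel.
Proof. by move=> x; rewrite /add_edge_rel /= adj_irrefl eqxx. Qed.

Definition add_edge : sgraph := SGraph add_edge_sym add_edge_irrefl.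

End AddEdge.

(* Main.v *)
(* Take a path on n vertices and attach s pendant vertices to each of its two
   ends, with n = q^2 and 2^s = q^6.  The subtrees containing both ends outnumber
   the others, which contain the pendant vertices of at most one end: there are
   at least 4^s of the former and only O(n^2 2^s) of the latter.  Before the ends
   are joined, a subtree containing both of them contains the whole path, so the
   density is close to 1.  Afterwards it can also miss an inner stretch of the
   resulting n-cycle, with about n^2/2 choices for the stretch; its length is
   n/3 on average, so the density drops to about 2/3. *)

Require Import Defs.
From mathcomp Require Import all_boot all_order all_algebra.
From mathcomp Require Import reals.
From mathcomp Require Import zify ring lra.

Import Order.TTheory GRing.Theory Num.Theory.

Set Implicit Arguments.
Unset Strict Implicit.
Unset Printing Implicit Defensive.

(** * Edges, connectivity, and a criterion for acyclicity *)

Lemma set2_eq (T : finType) (a b c d : T) :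
  [set a; b] = [set c; d] -> (a = c /\ b = d) \/ (a = d /\ b = c).
Proof.
move=> E.
have ha : a \in [set c; d] by rewrite -E set21.
have hb : b \in [set c; d] by rewrite -E set22.
have hc : c \in [set a; b] by rewrite E set21.
have hd : d \in [set a; b] by rewrite E set22.
move: ha hb hc hd; rewrite !inE.
by do 4! case/orP=> /eqP ?; subst; auto.
Qed.

Lemma in_edges (G : sgraph) (x y : G) : ([set x; y] \in edges G) = adj x y.
Proof.
apply/imsetP/idP => [[[a b]] | xy]; last by exists (x, y); rewrite ?inE.
rewrite inE /= => ab /set2_eq [[-> ->]|[-> ->]] //.
by rewrite adj_sym.
Qed.

Lemma edges_add_edge (G : sgraph) (u v : G) : u != v ->
  edges (add_edge u v) = [set u; v] |: edges G.
Proof.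
move=> uv; apply/setP => A; apply/idP/setU1P.
  case/imsetP => -[x y]; rewrite inE /= => /orP[xy|/andP[_ /eqP ->]] ->; last by left.
  by right; rewrite in_edges.
case=> [->|/imsetP [[x y]]]; last rewrite inE => xy ->; rewrite in_edges.
  by apply/orP; right; apply/andP.
by apply/orP; left.
Qed.

Lemma edge_rel_sym (T : finType) (E : {set {set T}}) : symmetric (edge_rel E).
Proof. by move=> x y; rewrite /edge_rel /= setUC. Qed.

Lemma connected_on_cut (T : finType) (V : {set T}) (e : rel T) (X : pred T) :
  connected_on V e -> (forall x y, e x y -> X x -> X y) ->
  forall x y, x \in V -> y \in V -> X x -> X y.
Proof.
case/andP=> _ /forallP cV eX x y xV yV.
move: (cV x); rewrite xV => /forallP/(_ y); rewrite yV => /connectP [p].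
elim: p x {xV} => [|z p IH] x /=; first by move=> _ ->.
by case/andP=> /eX xz /IH{}IH /IH{}IH /xz.
Qed.

Lemma connected_on_root (T : finType) (V : {set T}) (e : rel T) (r : T) :
  symmetric e -> r \in V -> {in V, forall x, connect e r x} -> connected_on V e.
Proof.
move=> e_sym rV cr; apply/andP; split; first by apply/set0Pn; exists r.
apply/forall_inP => x xV; apply/forall_inP => y yV.
by rewrite (connect_trans _ (cr y yV)) // (sym_connect_sym e_sym) cr.
Qed.

(** On a cycle, a vertex of maximal rank has two distinct neighbours, neither of larger rank. *)
Lemma acyclic_rank (T : finType) (e : rel T) (r : T -> nat) :
  symmetric e ->
  (forall x y z, e x y -> e x z -> r y <= r x -> r z <= r x -> y = z) ->
  acyclic e.
Proof.
move=> e_sym r_e; apply/negP=> /existsP[k /existsP[c /and3P[k2 c_uniq ce]]].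
have : size c = k by rewrite size_tuple.
case def_c: (val c) => [|x0 c0]; first by move=> k0; rewrite -k0 in k2.
move=> sz.
have x0c : x0 \in val c by rewrite def_c mem_head.
case: (arg_maxnP r x0c) => x xc x_max.
(* Rotated to start at [x], the cycle has the two neighbours of [x] as its second and last
   entries. *)
case: (rot_to xc) => i p def_p.
have p_uniq : uniq (x :: p) by rewrite -def_p rot_uniq.
have pe : cycle e (x :: p) by rewrite -def_p rot_cycle.
have px y : y \in x :: p -> r y <= r x.
  by rewrite -def_p mem_rot; apply: x_max.
have szp : size (x :: p) = k by rewrite -def_p size_rot def_c.
case: p {def_p} p_uniq pe px szp => [|y p].
  by move=> _ _ _ k1; rewrite -k1 in k2.
case/lastP: p => [|p z]; first by move=> _ _ _ k1; rewrite -k1 in k2.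
move=> p_uniq /= /andP[xy]; rewrite rcons_path last_rcons => /andP[_ zx] px _.
have yz : y = z.
  apply: (r_e x) => //; first by rewrite e_sym.
    by apply: px; rewrite !inE eqxx orbT.
  by apply: px; rewrite !inE mem_rcons mem_head !orbT.
by move: p_uniq; rewrite /= yz mem_rcons mem_head andbF.
Qed.

(** * The broom, its closure by one edge, and their edge sets *)

Section Broom.

Variables m s : nat.
(** At least three path vertices: the ends are then nonadjacent, and joining them creates a genuine
    cycle. *)
Notation n := m.+3.

Definition leaf := (bool * 'I_s)%type.
Definition broom_vertex := ('I_n + leaf)%type.

Definition stem (l : leaf) : 'I_n := if l.1 then ord_max else ord0.

Definition broom_adj : rel broom_vertex := fun x y =>
  match x, y with
  | inl i, inl j => (j == i.+1 :> nat) || (i == j.+1 :> nat)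
  | inl i, inr l | inr l, inl i => i == stem l
  | inr _, inr _ => false
  end.

Lemma broom_adj_sym : symmetric broom_adj.
Proof. by move=> [i|l] [j|k] //=; rewrite orbC. Qed.

Lemma broom_adj_irrefl : irreflexive broom_adj.
Proof. by move=> [i|l] //=; lia. Qed.

Definition broom : sgraph := SGraph broom_adj_sym broom_adj_irrefl.

Definition v0 : broom := inl ord0.
Definition vmax : broom := inl ord_max.

Definition closed_broom : sgraph := add_edge v0 vmax.

(** [ordS] wraps around, so [cedge ord_max] is the edge joining the two ends, absent from
    [broom]. *)
Definition cedge (i : 'I_n) : {set broom} := [set inl i; inl (ordS i)].
Definition ledge (l : leaf) : {set broom} := [set inl (stem l); inr l].
Definition edge_set (F : {set 'I_n}) (L : {set leaf}) : {set {set broom}} :=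
  cedge @: F :|: ledge @: L.

Lemma ordS_max : ordS (ord_max : 'I_n) = ord0.
Proof. by apply/val_inj; rewrite /= modnn. Qed.

Lemma ordS_val (i : 'I_n) : i != ord_max -> ordS i = i.+1 :> nat.
Proof.
rewrite -val_eqE /= => i_max; rewrite modn_small //.
by have := ltn_ord i; lia.
Qed.

(** Equality with the ends swapped would mean [i = ordS j] and [j = ordS i], impossible on a cycle
    of length at least 3. *)
Lemma cedge_inj : injective cedge.
Proof.
move=> i j /set2_eq [[[]] //|[[ij] [ji]]].
case: (eqVneq i ord_max) => [im|im]; case: (eqVneq j ord_max) => [jm|jm].
- by rewrite im jm.
- have := ordS_val jm; rewrite -ij im /= => jv.
  by have := ji; rewrite im ordS_max => jv'; move: jv; rewrite -jv'.
- have := ordS_val im; rewrite ji jm /= => jv.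
  by have := ij; rewrite jm ordS_max => jv'; move: jv; rewrite jv'.
- by have := ordS_val im; have := ordS_val jm; rewrite -ij ji; lia.
Qed.

Lemma ledge_inj : injective ledge.
Proof. by move=> l k /set2_eq [[_ []] //|[]]. Qed.

Lemma cedge_ledge i l : cedge i <> ledge l.
Proof. by move/set2_eq => [[]|[]]. Qed.

Lemma mem_cedge F L i : (cedge i \in edge_set F L) = (i \in F).
Proof.
rewrite inE mem_imset; last exact: cedge_inj.
case: imsetP => [[l _ /cedge_ledge]//|_]; exact: orbF.
Qed.

Lemma mem_ledge F L l : (ledge l \in edge_set F L) = (l \in L).
Proof.
rewrite inE (mem_imset _ _ ledge_inj).
by case: imsetP => [[i _ /esym/cedge_ledge]//|_].
Qed.

Lemma edge_setP (F : {set 'I_n}) (L : {set leaf}) (x y : broom) :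
  reflect [\/ exists2 i, i \in F & (x = inl i /\ y = inl (ordS i)),
              exists2 i, i \in F & (y = inl i /\ x = inl (ordS i)),
              exists2 l, l \in L & (x = inl (stem l) /\ y = inr l) |
              exists2 l, l \in L & (y = inl (stem l) /\ x = inr l)]
    (edge_rel (edge_set F L) x y).
Proof.
apply: (iffP idP) => /=.
  case/setUP => /imsetP [i iF /set2_eq [[-> ->]|[-> ->]]].
  - by constructor 1; exists i.
  - by constructor 2; exists i.
  - by constructor 3; exists i.
  - by constructor 4; exists i.
case=> [[i iF [-> ->]]|[i iF [-> ->]]|[l lL [-> ->]]|[l lL [-> ->]]].
- by rewrite /edge_rel /= mem_cedge.
- by rewrite /edge_rel /= setUC mem_cedge.
- by rewrite /edge_rel /= mem_ledge.
- by rewrite /edge_rel /= setUC mem_ledge.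
Qed.

Lemma edge_setS F L F0 L0 :
  (edge_set F L \subset edge_set F0 L0) = (F \subset F0) && (L \subset L0).
Proof.
apply/subsetP/andP => [sE | [/subsetP sF /subsetP sL] A].
  split; apply/subsetP => i iF.
    by rewrite -(mem_cedge F0 L0) sE // mem_cedge.
  by rewrite -(mem_ledge F0 L0) sE // mem_ledge.
case/setUP => /imsetP [i iF ->]; first by rewrite mem_cedge sF.
by rewrite mem_ledge sL.
Qed.

Lemma edges_broom : edges broom = edge_set (~: [set ord_max]) setT.
Proof.
apply/setP => A; apply/idP/idP.
  case/imsetP => -[x y]; rewrite inE /= => xy ->; move: xy.
  case: x y => [i|l] [j|k] //=.
  - case/orP=> /eqP h.
      have im : i != ord_max by rewrite -val_eqE /=; have := ltn_ord j; lia.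
      have -> : j = ordS i by apply/ord_inj; rewrite ordS_val.
      by rewrite mem_cedge !inE.
    have im : j != ord_max by rewrite -val_eqE /=; have := ltn_ord i; lia.
    have -> : i = ordS j by apply/ord_inj; rewrite ordS_val.
    by rewrite setUC mem_cedge !inE.
  - by move/eqP->; rewrite mem_ledge inE.
  - by move/eqP->; rewrite setUC mem_ledge inE.
case/setUP => /imsetP [i im ->]; rewrite in_edges /=.
  by rewrite !inE in im; apply/orP; left; apply/eqP/ordS_val.
exact: eqxx.
Qed.

Lemma edges_closed_broom : edges closed_broom = edge_set setT setT.
Proof.
rewrite edges_add_edge // edges_broom.
have -> : [set v0; vmax] = cedge ord_max by rewrite /cedge ordS_max setUC.
apply/setP => A; apply/setU1P/idP => [[->|]|].
- by rewrite mem_cedge inE.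
- by apply/subsetP; rewrite edge_setS !subsetT.
case/setUP => /imsetP [i _ ->]; last by right; rewrite mem_ledge inE.
have [->|im] := eqVneq i ord_max; first by left.
by right; rewrite mem_cedge !inE.
Qed.

Lemma edge_setE F0 L0 (E : {set {set broom}}) : E \subset edge_set F0 L0 ->
  E = edge_set [set i | cedge i \in E] [set l | ledge l \in E].
Proof.
move=> /subsetP sE; apply/setP => A; apply/idP/idP => [AE|].
  case/setUP: (sE _ AE) => /imsetP [i _ Ai]; rewrite Ai.
    by rewrite mem_cedge inE -Ai.
  by rewrite mem_ledge inE -Ai.
by case/setUP => /imsetP [i]; rewrite inE => ? ->.
Qed.

(** A pendant vertex takes the position of its stem, so that pendant edges never cross a cut of the
    cycle. *)
Definition pos (x : broom) : 'I_n := match x with inl i => i | inr l => stem l end.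

(** Only the cycle edges [a] and [b] can join a position after [a] and up to [b] to one outside this
    range. *)
Lemma edge_set_cut (F : {set 'I_n}) L V (a b : 'I_n) :
  connected_on V (edge_rel (edge_set F L)) -> a \notin F -> b \notin F ->
  {in V &, forall x y, (a < pos x <= b) = (a < pos y <= b)}.
Proof.
move=> cV aF bF x y xV yV.
have step z w : edge_rel (edge_set F L) z w -> (a < pos z <= b) = (a < pos w <= b).
  have S i : i \in F -> (a < i <= b) = (a < ordS i <= b).
    move=> iF.
    have ia : i != a :> nat by apply: contraNneq aF => /ord_inj <-.
    have ib : i != b :> nat by apply: contraNneq bF => /ord_inj <-.
    case: (eqVneq i ord_max) => [im|/ordS_val ->]; last by move: ia ib; lia.
    (* The closing edge: [b] is not [ord_max] here, so neither of its ends lies in the range. *)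
    rewrite im ordS_max /= in ia ib *.
    by have := ltn_ord b; move: ib; lia.
  by case/edge_setP => [] [i iF [-> ->]] //=; rewrite S.
apply/idP/idP.
  by apply: (connected_on_cut (X := fun x => a < pos x <= b) cV) => // z w /step ->.
by apply: (connected_on_cut (X := fun x => a < pos x <= b) cV) => // z w /step ->.
Qed.

Lemma edge_set_full_cyclic L : ~~ acyclic (edge_rel (edge_set setT L)).
Proof.
(* Reducing modulo [n] gives [f n = f 0], so the closed walk is the image of 0, 1, ..., [n]. *)
pose f k : broom := inl (inord (k %% n)).
have f_size : size [seq f k | k <- iota 0 n] == n by rewrite size_map size_iota.
have n_lt : n < #|{: broom}|.+1.
  by rewrite ltnS card_sum card_ord leq_addr.
rewrite negbK; apply/existsP; exists (Ordinal n_lt).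
apply/existsP; exists (Tuple f_size); apply/and3P; split => //.
  rewrite map_inj_in_uniq ?iota_uniq // => i j.
  rewrite !mem_iota !add0n /f => /andP[_ iN] /andP[_ jN] [] /(congr1 val) /=.
  by rewrite !modn_small // !inordK.
change (path (edge_rel (edge_set setT L)) (f 0) (rcons (map f (iota 1 m.+2)) (f 0))).
have f0 : f 0 = f n by rewrite /f modnn mod0n.
rewrite {2}f0 -map_rcons.
have -> : rcons (iota 1 m.+2) n = iota 1 n by rewrite -[in RHS](addn1 m.+2) iotaD cats1.
rewrite path_map.
apply: (@sub_path _ (fun j k => k == j.+1)) => [j k /eqP ->|].
  apply/edge_setP; constructor 1; exists (inord (j %% n)); first by rewrite inE.
  split=> //; congr inl; apply/val_inj => /=.
  by rewrite !inordK ?ltn_mod // -addn1 -modnDml addn1.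
by elim: (n) (0) => //= k IH i; rewrite eqxx IH.
Qed.


(** * Subtrees of the closed broom, in particular those containing both ends *)

Lemma subgraph_edge_set (V : {set broom}) (F : {set 'I_n}) (L : {set leaf}) :
  reflect ((forall i, i \in F -> inl i \in V /\ inl (ordS i) \in V) /\
           (forall l, l \in L -> inl (stem l) \in V /\ inr l \in V))
    (cover (edge_set F L) \subset V).
Proof.
apply: (iffP bigcupsP) => [sV | [VF VL] A].
  split=> i iF.
    have /subsetP iV : cedge i \subset V by apply: sV; rewrite mem_cedge.
    by split; apply: iV; rewrite ?set21 ?set22.
  have /subsetP iV : ledge i \subset V by apply: sV; rewrite mem_ledge.
  by split; apply: iV; rewrite ?set21 ?set22.
case/setUP => /imsetP [i iF ->]; apply/subsetP => x.
  by have [? ?] := VF i iF; case/set2P => ->.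
by have [? ?] := VL i iF; case/set2P => ->.
Qed.

Variant closed_broom_subtree_spec :
    {set broom} * {set {set broom}} -> Prop :=
  ClosedBroomSubtree (V : {set broom}) (F : {set 'I_n}) (L : {set leaf}) of
    connected_on V (edge_rel (edge_set F L)) & acyclic (edge_rel (edge_set F L)) &
    (forall i, i \in F -> inl i \in V /\ inl (ordS i) \in V) &
    (forall l, l \in L -> inl (stem l) \in V /\ inr l \in V) :
  closed_broom_subtree_spec (V, edge_set F L).

Lemma closed_broom_subtreeP S :
  S \in subtrees closed_broom -> closed_broom_subtree_spec S.
Proof.
case: S => V E; rewrite inE /subgraph /is_tree /= edges_closed_broom.
case/andP => /andP[/edge_setE ->].
by move=> /subgraph_edge_set [VF VL] /andP[cV aV]; constructor.
Qed.

(* The path vertices strictly after [a] and up to [b] are left out; the edges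
   left out are the cycle edges number [a], ..., [b]. *)
Definition gap_tree (a b : 'I_n) (L : {set leaf}) :
    {set broom} * {set {set broom}} :=
  ([set x : broom | match x with inl i => ~~ (a < i <= b) | inr l => l \in L end],
   edge_set [set i : 'I_n | ~~ (a <= i <= b)] L).

(** The second conjunct keeps the end [ord_max] in the tree. The pair [(ord_max, ord_max)] leaves
    out the closing edge and no vertex. *)
Definition is_gap (a b : 'I_n) : bool :=
  (a <= b) && ((b == ord_max) ==> (a == ord_max)).

Lemma ord_max_notin_gap a b : is_gap a b -> ~~ (a < (ord_max : 'I_n) <= b).
Proof.
case/andP=> _ /implyP bm; apply/negP => /andP[am mb].
have bmax : b == ord_max by rewrite -val_eqE /= in mb *; have := ltn_ord b; lia.
by move: am; rewrite (eqP (bm bmax)) /= ltnn.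
Qed.

Lemma stem_notin_gap a b l : is_gap a b -> ~~ (a < stem l <= b).
Proof. by rewrite /stem; case: (l.1) => //; exact: ord_max_notin_gap. Qed.

Definition spans (S : {set broom} * {set {set broom}}) : bool :=
  (v0 \in S.1) && (vmax \in S.1).

(** Acyclicity forces a cycle edge to be missing; [a] and [b] are the first and the last such edge.
    Since [v0] is outside the range they cut off, the connected tree avoids that range entirely. *)
Lemma spanning_subtreeP S : S \in subtrees closed_broom -> spans S ->
  exists a b L, is_gap a b /\ S = gap_tree a b L.
Proof.
case/closed_broom_subtreeP => V F L cV aV VF VL /andP[/= v0V vmV].
have [i0 i0F] : exists i, i \notin F.
  apply/existsP; rewrite -negb_forall; apply: contraL aV => /forallP FT.
  have -> : F = setT by apply/setP => i; rewrite FT inE.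
  exact: edge_set_full_cyclic.
case: (@arg_minnP _ i0 (fun i => i \notin F) val i0F) => a aF a_min.
case: (@arg_maxnP _ i0 (fun i => i \notin F) val i0F) => b bF b_max.
have ab : a <= b by apply: a_min.
have cut x : x \in V -> ~~ (a < pos x <= b).
  by move=> xV; rewrite (edge_set_cut cV aF bF xV v0V).
exists a, b, L; split.
  rewrite /is_gap ab; apply/implyP => /eqP bm.
  by have := cut _ vmV; rewrite bm -val_eqE /=; have := ltn_ord a; lia.
have FE : F = [set i : 'I_n | ~~ (a <= i <= b)].
  apply/setP => i; rewrite inE; apply/idP/idP => [iF | ].
    have ia : a != i :> nat by apply: contraNneq aF => /ord_inj ->.
    by have := cut _ (VF _ iF).1 => /=; lia.
  apply: contraR => iF; have := a_min _ iF; have := b_max _ iF => /=; lia.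
congr pair; last by rewrite -FE.
apply/setP => -[i|l]; rewrite inE.
  apply/idP/idP => [/cut //|].
  (* Outside the gap, a vertex other than 0 is an end of a kept edge: edge [i.-1] if [i <= a], edge
     [i] if [b < i]. *)
  rewrite negb_and -leqNgt -ltnNge => /orP[ia|bi].
    case: (posnP i) => [i_0|i_gt0].
      by have -> : i = ord0 by apply/ord_inj.
    have i1n : i.-1 < n by have := ltn_ord i; lia.
    have i1m : Ordinal i1n != ord_max by rewrite -val_eqE /=; have := ltn_ord i; lia.
    have -> : i = ordS (Ordinal i1n) by apply/ord_inj; rewrite ordS_val //=; lia.
    by apply: (VF _ _).2; rewrite FE inE /=; lia.
  by apply: (VF _ _).1; rewrite FE inE; lia.
apply/idP/idP => [lV|/VL[]//].
(* Without its pendant edge, [inr l] would be cut off from [v0]. *)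
apply: contraT => lL.
have /eqP // : inl ord0 == inr l :> broom.
apply: (connected_on_cut (X := pred1 (inr l)) cV _ lV v0V) => //= x y.
by case/edge_setP => [] [i iF [-> ->]] //= /eqP[] il; rewrite -il iF in lL.
Qed.

(** Vertices up to [a] are reached from [v0] along the path, those after [b] through the closing
    edge and then downwards. *)
Lemma gap_tree_connected a b L : is_gap a b ->
  connected_on (gap_tree a b L).1 (edge_rel (gap_tree a b L).2).
Proof.
move=> gap_ab; have /andP[ab /implyP bm] := gap_ab.
set e := edge_rel _; have e_sym : symmetric e by exact: edge_rel_sym.
have ce (i : 'I_n) : ~~ (a <= i <= b) -> e (inl i) (inl (ordS i)).
  by move=> iF; apply/edge_setP; constructor 1; exists i; rewrite ?inE.
have low k (kn : k < n) : k <= a -> connect e v0 (inl (Ordinal kn)).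
  elim: k kn => [|k IH] kn ka.
    by have -> : Ordinal kn = ord0 by apply/val_inj.
  have kn' : k < n by lia.
  apply: (connect_trans (IH kn' (ltnW ka))); apply: connect1.
  have km : Ordinal kn' != ord_max by rewrite -val_eqE /=; lia.
  have -> : Ordinal kn = ordS (Ordinal kn') by apply/ord_inj; rewrite ordS_val.
  by apply: ce => /=; lia.
have high k (i : 'I_n) : i + k = m.+2 -> b < i -> connect e v0 (inl i).
  elim: k i => [|k IH] i ik bi.
    have im : i = ord_max by apply/ord_inj => /=; lia.
    apply: connect1; rewrite e_sym -[v0]/(inl ord0) -ordS_max -im.
    by apply: ce; lia.
  have im : i != ord_max by rewrite -val_eqE /=; lia.
  have Si := ordS_val im.
  apply: (connect_trans (IH (ordS i) _ _)); rewrite ?Si; try lia.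
  by apply: connect1; rewrite e_sym; apply: ce; lia.
have path_v0 (i : 'I_n) : ~~ (a < i <= b) -> connect e v0 (inl i).
  rewrite negb_and -leqNgt -ltnNge => /orP[ia|bi].
    by case: i ia => i iN /= ia; apply: low.
  by apply: (high (m.+2 - i)); have := ltn_ord i; lia.
apply: (connected_on_root (r := v0)) => //; first by rewrite inE.
move=> [i|l]; rewrite inE; first exact: path_v0.
move=> lL; apply: (@connect_trans _ _ (inl (stem l))); last first.
  by apply: connect1; apply/edge_setP; constructor 3; exists l.
exact/path_v0/stem_notin_gap.
Qed.

(* Once the edges [a], ..., [b] are cut, the cycle becomes the path
   [b+1, ..., max, 0, ..., a]; the rank is the position along it. *)
Lemma gap_tree_acyclic (a b : 'I_n) L : a <= b -> acyclic (edge_rel (gap_tree a b L).2).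
Proof.
move=> ab.
pose r (x : broom) := match x with
  inl i => if b < i then nat_of_ord i else i + n | inr l => n + n end.
apply: (acyclic_rank (r := r)); first exact: edge_rel_sym.
have rS (i : 'I_n) : ~~ (a <= i <= b) -> r (inl i) < r (inl (ordS i)).
  move=> iF; rewrite /r.
  case: (eqVneq i ord_max) => [im|/ordS_val ->].
    rewrite im ordS_max /= in iF *; have := ltn_ord b.
    by move: iF; case: ifP; lia.
  by case: ifP; case: ifP; lia.
have rn (i : 'I_n) : r (inl i) < n + n.
  by rewrite /r; have := ltn_ord i; case: ifP; lia.
(* Rank [n + n] puts pendant vertices above the path, so a neighbour of no larger rank is the
   predecessor or the stem. *)
have down x y : edge_rel (gap_tree a b L).2 x y -> r y <= r x ->
    (exists2 i, x = inl (ordS i) & y = inl i) \/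
    (exists2 l, x = inr l & y = inl (stem l)).
  case/edge_setP => [] [i iF [-> ->]]; rewrite ?inE in iF.
  - by rewrite leqNgt rS.
  - by left; exists i.
  - by rewrite leqNgt rn.
  - by right; exists i.
move=> x y z xy xz /(down _ _ xy) yx /(down _ _ xz).
case: yx => [] [i -> ->] [] [j] // E ->.
  by rewrite (ordS_inj (congr1 pos E)).
by case: E => ->.
Qed.

Lemma gap_tree_subtree a b L : is_gap a b -> gap_tree a b L \in subtrees closed_broom.
Proof.
move=> ab; rewrite inE /is_tree gap_tree_connected //.
have /andP[a_b _] := ab.
rewrite gap_tree_acyclic // !andbT /subgraph edges_closed_broom edge_setS !subsetT /=.
apply/subgraph_edge_set; split=> i; rewrite !inE.
  move=> iF; split; first by lia.
  case: (eqVneq i ord_max) => [->|/ordS_val ->]; first by rewrite ordS_max.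
  by lia.
by move=> iL; split=> //; exact: stem_notin_gap.
Qed.

(** The missing cycle edges form the nonempty interval from [a] to [b], which determines its
    endpoints. *)
Lemma gap_tree_inj (a b : 'I_n) L (a' b' : 'I_n) L' : a <= b -> a' <= b' ->
  gap_tree a b L = gap_tree a' b' L' -> [/\ a = a', b = b' & L = L'].
Proof.
move=> ab ab' [_ E].
have F_eq (i : 'I_n) : (a <= i <= b) = (a' <= i <= b').
  have := congr1 (fun E : {set {set broom}} => cedge i \in E) E.
  by rewrite /= !mem_cedge !inE => /negb_inj.
split.
- by apply/ord_inj; have := F_eq a; have := F_eq a'; lia.
- by apply/ord_inj; have := F_eq b; have := F_eq b'; lia.
by apply/setP => l; rewrite -(mem_ledge [set i : 'I_n | ~~ (a <= i <= b)]) E mem_ledge.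
Qed.

Lemma card_gap_tree (a b : 'I_n) L : a <= b ->
  #|(gap_tree a b L).1| + (b - a) = n + #|L|.
Proof.
move=> ab; rewrite -sum1_card big_sumType /= addnAC; congr addn; last first.
  by rewrite -sum1_card; apply: eq_bigl => l; rewrite inE.
have -> : b - a = \sum_(i < n | a < i <= b) 1.
  rewrite -(big_mkord (fun i => a < i <= b) (fun=> 1)).
  have bn : b < n by [].
  (* Splitting the range at [a.+1] and [b.+1] isolates the gap as the middle part. *)
  rewrite (@big_cat_nat _ _ _ a.+1) //=.
  rewrite big1_seq ?add0n; last by move=> i; rewrite mem_index_iota; lia.
  rewrite (@big_cat_nat _ _ _ b.+1) //=.
  rewrite [X in _ + X]big1_seq ?addn0; last by move=> i; rewrite mem_index_iota; lia.
  rewrite big_seq_cond (eq_bigl (fun i => i \in index_iota a.+1 b.+1)).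
    by rewrite -big_seq sum1_size size_iota; lia.
  by move=> i; rewrite mem_index_iota; lia.
rewrite addnC -[RHS]card_ord -[RHS]sum1_card.
rewrite [RHS](bigID (fun i : 'I_n => a < i <= b)) /=; congr addn.
by apply: eq_bigl => i; rewrite inE.
Qed.

(** * Subtrees that miss an end of the path, and a bound on their number *)

Definition arc_edges (lo hi : 'I_n) (c : bool) (A : {set 'I_s}) :=
  edge_set [set i : 'I_n | lo <= i < hi] [set l : leaf | (l.1 == c) && (l.2 \in A)].

(** A vertex on no edge is cut off from all others, so connectivity makes it the only one. Counting
    subtrees thus reduces to counting edge sets. *)
Lemma tree_vertices (V : {set broom}) F L :
  connected_on V (edge_rel (edge_set F L)) ->
  cover (edge_set F L) \subset V ->
  V = cover (edge_set F L) \/ exists x, V = [set x] /\ edge_set F L = set0.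
Proof.
move=> cV sV; set E := edge_set F L in cV sV *.
have [sE|/subsetPn[x xV xE]] := boolP (V \subset cover E).
  by left; apply/eqP; rewrite eqEsubset sE.
right; exists x.
have Vx : V = [set x].
  apply/setP => y; rewrite inE; apply/idP/eqP => [yV|-> //].
  apply/eqP; apply: (connected_on_cut (X := pred1 x) cV _ xV yV) => //= z w zw /eqP zx.
  by case/negP: xE; rewrite -zx; apply/bigcupP; exists [set z; w]; rewrite ?set21.
split=> //.
have c0 y : y \notin cover E.
  apply: contra xE => yE; have /(subsetP sV) := yE.
  by rewrite Vx inE => /eqP <-.
apply/setP => A; rewrite in_set0; apply/negP => AE.
case/setUP: (AE) => /imsetP [i iF iA].
  by have /bigcupP := c0 (inl i); case; exists A; rewrite // iA set21.
by have /bigcupP := c0 (inr i); case; exists A; rewrite // iA set22.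
Qed.

(** The closing edge would bring in both ends, so it is absent; pendant edges can only hang from an
    end that is present. *)
Lemma nonspanning_subtreeP S : S \in subtrees closed_broom -> ~~ spans S ->
  (exists lo hi c A, S = (cover (arc_edges lo hi c A), arc_edges lo hi c A)) \/
  (exists x, S = ([set x], set0)).
Proof.
case/closed_broom_subtreeP => V F L cV aV VF VL nspan.
have sV : cover (edge_set F L) \subset V by apply/subgraph_edge_set.
case: (tree_vertices cV sV) => [VE|[x [-> ->]]]; last by right; exists x.
left; have mF : ord_max \notin F.
  apply: contra nspan => /VF [mV]; rewrite ordS_max => zV.
  by rewrite /spans /= mV zV.
have [c Lc] : exists c, {in L, forall l, l.1 = c}.
  case/nandP: nspan => /= [zV|mV].
    exists true => l /VL [+ _]; rewrite /stem; case: (l.1) => // zV'.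
    by rewrite zV' in zV.
  exists false => l /VL [+ _]; rewrite /stem; case: (l.1) => // mV'.
  by rewrite mV' in mV.
have [lo [hi FE]] : exists lo hi : 'I_n, F = [set i : 'I_n | lo <= i < hi].
  have [->|[i0 i0F]] := set_0Vmem F.
    by exists ord0, ord0; apply/setP => i; rewrite !inE /=; lia.
  case: (@arg_minnP _ i0 (fun i => i \in F) val i0F) => lo loF lo_min.
  case: (@arg_maxnP _ i0 (fun i => i \in F) val i0F) => hi hiF hi_max.
  have him : hi != ord_max by apply: contraNneq mF => <-.
  (* [hi] is the last kept edge, while the upper bound in [arc_edges] is exclusive. *)
  exists lo, (ordS hi); apply/setP => i; rewrite inE (ordS_val him).
  apply/idP/idP => [iF|loihi].
    by have := lo_min _ iF; have := hi_max _ iF => /=; lia.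
  apply: contraT => iF.
  (* If edge [i] were missing, it and the missing closing edge would separate [lo] from
     [ordS hi]. *)
  have := edge_set_cut cV iF mF (VF _ loF).1 (VF _ hiF).2.
  have iN : i != hi :> nat by apply: contraNneq iF => /ord_inj ->.
  by rewrite /pos (ordS_val him) /=; move: him; rewrite -val_eqE /=; have := ltn_ord hi; lia.
have E_arc : edge_set F L = arc_edges lo hi c [set k | (c, k) \in L].
  rewrite /arc_edges FE; congr (edge_set _ _); apply/setP => -[c' k]; rewrite !inE /=.
  apply/idP/andP => [lL|[/eqP-> //]].
  by have /= cc := Lc _ lL; rewrite -cc eqxx cc -{1}cc.
by exists lo, hi, c, [set k | (c, k) \in L]; rewrite {1}VE E_arc.
Qed.

(** The first term counts the choices of [lo], [hi], [c] and [A] in [arc_edges], the second the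
    single-vertex trees. *)
Definition light_bound := 2 * n ^ 2 * 2 ^ s + (n + 2 * s).

Lemma card_broom : #|broom| = n + 2 * s.
Proof. by rewrite card_sum card_prod card_bool !card_ord. Qed.

Lemma card_nonspanning :
  #|[set S in subtrees closed_broom | ~~ spans S]| <= light_bound.
Proof.
pose f (p : 'I_n * 'I_n * bool * {set 'I_s}) :=
  let E := arc_edges p.1.1.1 p.1.1.2 p.1.2 p.2 in (cover E, E).
pose g (x : broom) : {set broom} * {set {set broom}} := ([set x], set0).
apply: (@leq_trans #|f @: setT :|: g @: setT|).
  apply/subset_leq_card/subsetP => S; rewrite inE => /andP[St Sn].
  case: (nonspanning_subtreeP St Sn) => [[lo [hi [c [A ->]]]]|[x ->]].
    by apply/setUP; left; apply/imsetP; exists (lo, hi, c, A).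
  by apply/setUP; right; apply/imsetP; exists x.
apply: (leq_trans (leq_card_setU _ _)); apply: leq_add.
  apply: (leq_trans (leq_imset_card _ _)).
  rewrite cardsT !card_prod card_bool !card_ord.
  by rewrite -[#|{: {set _}}|]cardsT -powersetT card_powerset cardsT card_ord; lia.
by apply: (leq_trans (leq_imset_card _ _)); rewrite cardsT card_broom.
Qed.

(** * Gaps and sums over them *)

Definition gaps : {set 'I_n * 'I_n} := [set p | is_gap p.1 p.2].

(** Reindexing along [gap_tree]. A constant [f] will give the number of these subtrees, the identity
    their total order. *)
Lemma sum_spanning (f : nat -> nat) :
  \sum_(S in subtrees closed_broom | spans S) f #|S.1| =
  \sum_(p in gaps) \sum_(L : {set leaf}) f (n + #|L| - (p.2 - p.1)).
Proof.
pose h (p : 'I_n * 'I_n * {set leaf}) := gap_tree p.1.1 p.1.2 p.2.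
have -> : \sum_(S in subtrees closed_broom | spans S) f #|S.1| =
    \sum_(S in h @: setX gaps setT) f #|S.1|.
  apply: eq_bigl => S; apply/andP/imsetP => [[St Ss]|[[[a b] L]]].
    have [a [b [L [ab SE]]]] := spanning_subtreeP St Ss.
    by exists (a, b, L); rewrite ?SE // !inE ab.
  case/setXP => gab _ ->; have ab : is_gap a b by move: gab; rewrite inE.
  split; first exact: gap_tree_subtree.
  rewrite /spans !inE /=; exact: ord_max_notin_gap.
rewrite big_imset /=; last first.
  move=> [[a b] L] [[a' b'] L']; rewrite !inE !andbT /= => /andP[ab _] /andP[ab' _].
  by move/(gap_tree_inj ab ab') => /= [-> -> ->].
rewrite pair_big /=; apply: eq_big => [[[a b] L]|[[a b] L]]; rewrite !inE ?andbT //=.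
case/andP=> ab _; congr f; rewrite -(card_gap_tree L ab) addnK //.
Qed.

(** For [b] below [ord_max], the length [b - a] runs through 0, ..., [b]; the final [f 0] comes from
    [(ord_max, ord_max)]. *)
Lemma sum_gaps (f : nat -> nat) :
  \sum_(p in gaps) f (p.2 - p.1) = \sum_(b < m.+2) \sum_(d < b.+1) f d + f 0.
Proof.
transitivity (\sum_(b < n) \sum_(a < n | is_gap a b) f (b - a)).
  rewrite (exchange_big_dep xpredT) //= pair_big_dep /=.
  by apply: eq_bigl => -[a b]; rewrite inE.
rewrite big_ord_recr /=; congr addn.
  apply: eq_bigr => b _.
  have bn : b.+1 <= n by have := ltn_ord b; lia.
  transitivity (\sum_(a < b.+1) f (b - a)).
    rewrite (big_ord_widen _ (fun a => f (b - a)) bn); apply: eq_bigl => a.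
    by rewrite /is_gap -!val_eqE /=; have := ltn_ord b; have := ltn_ord a; lia.
  rewrite (reindex_inj rev_ord_inj) /=; apply: eq_bigr => d _.
  by congr f; have := ltn_ord d; lia.
rewrite (big_pred1 ord_max) ?subnn // => a.
by rewrite /is_gap eqxx /= -val_eqE /=; have := ltn_ord a; lia.
Qed.

Lemma card_gaps : #|gaps| * 2 = m.+3 * m.+2 + 2.
Proof.
rewrite -sum1_card (sum_gaps (fun=> 1)) mulnDl; congr addn.
elim: (m.+2) => [|k IH]; first by rewrite big_ord0.
by rewrite big_ord_recr /= mulnDl IH sum1_card card_ord; lia.
Qed.

(** A sum of triangular numbers. Divided by the number of gaps, it gives a mean gap length of about
    [n] / 3. *)
Lemma sum_gap_sizes : (\sum_(p in gaps) (p.2 - p.1)) * 6 = m.+3 * m.+2 * m.+1.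
Proof.
rewrite (sum_gaps id) addn0.
have S1 k : (\sum_(d < k.+1) d) * 2 = k.+1 * k.
  elim: k => [|k IH]; first by rewrite big_ord_recr big_ord0.
  by rewrite big_ord_recr /= mulnDl IH; lia.
elim: (m.+1) => [|k IH]; first by rewrite !big_ord_recr !big_ord0.
rewrite big_ord_recr /= mulnDl IH; have := S1 k.+1.
by move: (\sum_(d < _) _) => X; nia.
Qed.

(** * Number and total order of the subtrees of both graphs *)

Lemma card_leaf_sets : #|{set leaf}| = 2 ^ (2 * s).
Proof.
rewrite -cardsT -powersetT card_powerset cardsT card_prod card_bool card_ord //.
Qed.

Lemma card_leaves (L : {set leaf}) : #|L| <= 2 * s.
Proof. by rewrite (leq_trans (max_card _)) // card_prod card_bool card_ord. Qed.

(** [Q] is the number of path vertices kept, summed over all gaps, and [l] the number of subtrees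
    missing an end. The lower bound ignores pendant vertices and those [l] subtrees; the upper bound
    takes [2 * s] for the former and the order of the graph for each of the latter. *)
Lemma closed_broom_order_sum :
  exists l Q, [/\ #|subtrees closed_broom| = 2 ^ (2 * s) * #|gaps| + l,
    l <= light_bound,
    Q + \sum_(p in gaps) (p.2 - p.1) = n * #|gaps|,
    2 ^ (2 * s) * Q <= \sum_(S in subtrees closed_broom) #|S.1| &
    \sum_(S in subtrees closed_broom) #|S.1| <=
      2 ^ (2 * s) * (Q + 2 * s * #|gaps|) + (n + 2 * s) * l].
Proof.
exists #|[set S in subtrees closed_broom | ~~ spans S]|.
exists (\sum_(p in gaps) (n - (p.2 - p.1))).
have gap_n (p : 'I_n * 'I_n) : p.2 - p.1 <= n by have := ltn_ord p.2; lia.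
split.
- rewrite -[LHS]sum1_card (bigID spans) /=; congr addn.
    rewrite (sum_spanning (fun=> 1)).
    under eq_bigr do rewrite sum1_card card_leaf_sets.
    by rewrite sum_nat_const mulnC.
  by rewrite -[RHS]sum1_card; apply: eq_bigl => S; rewrite [RHS]inE.
- exact: card_nonspanning.
- rewrite -big_split /= mulnC -sum_nat_const; apply: eq_bigr => p _.
  by rewrite subnK.
- rewrite (bigID spans) /=; apply: leq_trans (leq_addr _ _).
  rewrite (sum_spanning id) big_distrr /=; apply: leq_sum => p _.
  rewrite -card_leaf_sets -sum_nat_const; apply: leq_sum => L _.
  by rewrite -addnBAC ?gap_n // leq_addr.
rewrite (bigID spans) /=; apply: leq_add.
  rewrite (sum_spanning id) [2 * s * _]mulnC -sum_nat_const -big_split big_distrr /=.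
  apply: leq_sum => p _.
  rewrite -card_leaf_sets -sum_nat_const; apply: leq_sum => L _.
  by rewrite -addnBAC ?gap_n // leq_add2l card_leaves.
rewrite mulnC -sum_nat_const (eq_bigl (mem [set S in subtrees closed_broom | ~~ spans S])).
  by apply: leq_sum => S _; rewrite -card_broom max_card.
by move=> S; rewrite [RHS]inE.
Qed.

(** The two graphs differ by the closing edge only, and being a tree does not depend on the ambient
    graph. *)
Lemma in_subtrees_broom S : (S \in subtrees broom) =
  (S \in subtrees closed_broom) && (cedge ord_max \notin S.2).
Proof.
case: S => V E; rewrite [LHS]inE [X in _ = X && _]inE /subgraph /=.
rewrite edges_broom edges_closed_broom.
have -> : (E \subset edge_set (~: [set ord_max]) setT) =
    (E \subset edge_set setT setT) && (cedge ord_max \notin E).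
  apply/idP/andP => [sE|[sE mE]].
    split; first by rewrite (subset_trans sE) // edge_setS !subsetT.
    by apply/negP => /(subsetP sE); rewrite mem_cedge !inE eqxx.
  rewrite (edge_setE sE) edge_setS subsetT andbT; apply/subsetP => i.
  by rewrite !inE; apply: contraTneq => ->.
by apply/andP/andP => [[/andP[/andP[-> ->] ->] ->]|[/andP[/andP[-> ->] ->] ->]].
Qed.

(** Here [h] counts the subtrees containing both ends. Each contains the whole path, and every set
    of pendant vertices yields one. *)
Lemma broom_order_sum :
  exists h l, [/\ #|subtrees broom| = h + l, 2 ^ (2 * s) <= h, l <= light_bound &
    n * h <= \sum_(S in subtrees broom) #|S.1| <= (n + 2 * s) * (h + l)].
Proof.
exists #|[set S in subtrees broom | spans S]|.
exists #|[set S in subtrees broom | ~~ spans S]|.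
have cE : #|subtrees broom| =
    #|[set S in subtrees broom | spans S]| + #|[set S in subtrees broom | ~~ spans S]|.
  rewrite -[LHS]sum1_card (bigID spans) /= -!sum1_card.
  by congr addn; apply: eq_bigl => S; rewrite [RHS]inE.
split=> //.
- rewrite -card_leaf_sets -cardsT -(card_imset (f := gap_tree ord_max ord_max)).
    apply/subset_leq_card/subsetP => _ /imsetP [L _ ->].
    have mm : is_gap (ord_max : 'I_n) ord_max by rewrite /is_gap leqnn eqxx.
    apply/setIdP; split; last by rewrite /spans !inE /= ltnn.
    by rewrite in_subtrees_broom gap_tree_subtree // mem_cedge inE leqnn.
  by move=> L L' /gap_tree_inj [].
- apply: leq_trans card_nonspanning; apply/subset_leq_card/subsetP => S.
  by case/setIdP; rewrite in_subtrees_broom => /andP[St _] Ss; apply/setIdP.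
apply/andP; split; last first.
  by rewrite -cE mulnC -sum_nat_const; apply: leq_sum => S _; rewrite -card_broom max_card.
rewrite (bigID spans) /=; apply: leq_trans (leq_addr _ _).
rewrite mulnC -sum_nat_const [leqRHS](eq_bigl (mem [set S in subtrees broom | spans S])).
  apply: leq_sum => S /setIdP [].
  rewrite in_subtrees_broom => /andP[St mE] Ss.
  have [a [b [L [ab SE]]]] := spanning_subtreeP St Ss.
  (* The closing edge is missing, so [b], and then by [is_gap] also [a], is [ord_max]. *)
  move: mE ab; rewrite SE mem_cedge inE negbK /is_gap => /andP[am mb] /andP[ab /implyP bm].
  have bmax : b == ord_max by rewrite -val_eqE /=; have := ltn_ord b; move: mb => /=; lia.
  have := card_gap_tree L ab.
  by rewrite (eqP (bm bmax)) (eqP bmax) subnn addn0 => ->; exact: leq_addr.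
by move=> S; rewrite [RHS]inE.
Qed.

(** The gap tree with all pendant vertices and no path vertex left out covers the graph and uses
    only its edges. *)
Lemma connected_broom : connected broom.
Proof.
have mm : is_gap (ord_max : 'I_n) ord_max by rewrite /is_gap leqnn eqxx.
have /andP[_ /forall_inP cV] := gap_tree_connected (setT : {set leaf}) mm.
have VT x : x \in (gap_tree ord_max ord_max setT).1.
  by case: x => [i|l]; rewrite inE ?inE //=; have := ltn_ord i; lia.
apply: (connected_on_root (r := v0)); rewrite ?inE //; first exact: adj_sym.
move=> x _; have /forall_inP/(_ x (VT x)) := cV v0 (VT v0).
apply: connect_sub => y z yz; apply: connect1; rewrite -in_edges edges_broom.
move: yz; apply/subsetP; rewrite edge_setS subsetT andbT.
by apply/subsetP => i; rewrite !inE; apply: contraNneq => ->; rewrite leqnn.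
Qed.

End Broom.

(** * Mean order as a quotient, and estimates for the two densities *)

Local Open Scope ring_scope.

Lemma mean_subtree_orderE (R : realType) (G : sgraph) :
  mean_subtree_order R G =
  (\sum_(S in subtrees G) #|S.1|)%:R / #|subtrees G|%:R.
Proof.
rewrite /mean_subtree_order /subtree_poly linear_sum /= !horner_sum.
congr (_ / _).
  rewrite natr_sum; apply: eq_bigr => S _.
  by rewrite derivXn hornerMn hornerXn expr1n.
rewrite -sum1_card natr_sum; apply: eq_bigr => S _.
by rewrite hornerXn expr1n.
Qed.

(** [N] is at most [(1 + d) * n] and [h + l] at most [(1 + d) * h], so the ratio lies between 1 / (1
    + d)^2 and 1. *)
Lemma ratio_near_one (R : realFieldType) (n N h l W d : R) :
  0 < n -> n <= N -> N - n <= d * n -> 0 < h -> 0 <= l -> l <= d * h ->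
  0 <= d -> n * h <= W <= N * (h + l) -> `|W / (h + l) / N - 1| <= 2 * d.
Proof.
move=> n0 nN Nd h0 l0 ld d0 /andP[W1 W2].
have N0 : 0 < N by lra.
have D0 : 0 < (h + l) * N by apply: mulr_gt0 => //; lra.
rewrite -mulrA -invfM ler_norml lerBlDr lerBrDr ler_pdivrMr // ler_pdivlMr //.
have e1 : (N - n) * h <= d * n * h by rewrite ler_wpM2r // ltW.
have e2 : N * l <= N * (d * h) by rewrite ler_wpM2l // ltW.
have e3 : 0 <= d * ((N - n) * h) by rewrite !mulr_ge0 // ?subr_ge0 // ltW.
have e4 : 0 <= d * (N * l) by rewrite !mulr_ge0 // ltW.
have e5 : 0 <= d * (N * h) by rewrite !mulr_ge0 // ltW.
by apply/andP; split; lra.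
Qed.

(** [P] stands for the number of gaps, [M] for the number of sets of pendant vertices, and [d]
    bounds all relative errors. *)
Lemma ratio_near_two_thirds (R : realFieldType) (n N P Q M l W d : R) :
  3 <= n -> n <= N -> N - n <= d * n -> 0 < M -> 0 <= l -> l <= d * M ->
  0 <= d -> 1 <= d * n -> P * 2 = n * (n - 1) + 2 ->
  (n * P - Q) * 6 = n * (n - 1) * (n - 2) ->
  M * Q <= W <= M * (Q + (N - n) * P) + N * l ->
  `|W / (M * P + l) / N - 2 / 3| <= 3 * d.
Proof.
move=> n3 nN Nd M0 l0 ld d0 dn PE QE /andP[W1 W2].
have N0 : 0 < N by lra.
have P1 : 1 <= P by nra.
have P0 : 0 <= P by lra.
(* The two equations give Q = (2/3) n P + n^2/3; the excess n^2/3 is at most [P], hence at most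
   [d * (n * P)]. *)
have Q1 : 2 / 3 * (n * P) <= Q by nra.
have Q2 : Q <= (2 / 3 + d) * (n * P).
  have : n <= P * 3 by nra.
  have : P * 1 <= P * (d * n) by rewrite ler_wpM2l.
  by nra.
have MP0 : 0 <= M * P by rewrite mulr_ge0 // ltW.
have D0 : 0 < (M * P + l) * N.
  by rewrite mulr_gt0 // ltr_wpDr // mulr_gt0 //; lra.
rewrite -mulrA -invfM ler_norml lerBlDr lerBrDr ler_pdivrMr // ler_pdivlMr //.
have nMP : 0 <= n * (M * P) by rewrite mulr_ge0 //; lra.
have l_MP : l <= d * (M * P).
  by rewrite (le_trans ld) // ler_wpM2l // ler_peMr // ltW.
apply/andP; split.
  apply: le_trans W1; apply: (@le_trans _ _ (2 / 3 * (n * (M * P)))); last first.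
    have := ler_wpM2l (ltW M0) Q1; lra.
  (* If 2/3 - 3d is not positive, the bound is trivial. Otherwise the denominator is at most (1 +
     d)^2 n M P, and (2/3 - 3d)(1 + d)^2 <= 2/3. *)
  have [d29|d29] := leP (-(3 * d) + 2 / 3) 0.
    apply: (@le_trans _ _ 0); last by rewrite mulr_ge0 //; lra.
    by rewrite mulr_le0_ge0 // ltW.
  apply: (@le_trans _ _ ((-(3 * d) + 2 / 3) * ((1 + d) ^+ 2 * (n * (M * P))))).
    rewrite ler_wpM2l ?(ltW d29) //.
    rewrite (_ : _ ^+ 2 * _ = ((1 + d) * (M * P)) * ((1 + d) * n)); last by ring.
    by apply: ler_pM; rewrite ?addr_ge0 //; lra.
  rewrite (mulrA (_ + _)); apply: ler_wpM2r => //.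
  have : 0 <= d ^+ 2 by rewrite exprn_ge0.
  have : 0 <= d ^+ 3 by rewrite exprn_ge0.
  by rewrite !exprS expr0 !mulr1; nra.
apply: (le_trans W2).
have e1 := ler_wpM2l (ltW M0) Q2.
have e2 := ler_wpM2l MP0 Nd.
have e3 := ler_wpM2l (ltW N0) l_MP.
have e4 : 0 <= d * ((N - n) * (M * P)) by rewrite !mulr_ge0 ?subr_ge0 // ltW.
have e5 : 0 <= (N - n) * (M * P) by rewrite !mulr_ge0 ?subr_ge0 // ltW.
have e6 : 0 <= d * (N * l) by rewrite !mulr_ge0 // ltW.
have e7 : 0 <= N * l by rewrite !mulr_ge0 // ltW.
lra.
Qed.

Theorem theorem3p1 (R : realType) (eps : R) (eps_gt0 : 0 < eps) :
  exists (G : sgraph) (u v : G),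
    [/\ connected G, u != v, ~~ adj u v &
        `| (density R G - density R (add_edge u v)) - 1 / 3 | < eps].
Proof.
(* 75 = 5 * 15: the total error will be [5 * d] with [d = 15 / q] and [t%:R <= q]. *)
have [t t_gt0 t_eps] : exists2 t : nat, (0 < t)%N & 75 / eps < t%:R.
  exists (Num.bound (75 / eps)).+1 => //.
  by rewrite (lt_trans (archi_boundP _)) ?divr_ge0 ?ltW // ltr_nat.
pose q : R := 2 ^+ t.
have q_t : t%:R <= q by rewrite /q -natrX ler_nat ltnW // ltn_expl.
have q2 : 2 <= q by rewrite /q -(prednK t_gt0) exprS ler_peMr // exprn_ege1 // ler1n.
have [m nE] : exists m, (m.+3 = 2 ^ (2 * t))%N.
  exists (2 ^ (2 * t) - 3)%N.
  have : (2 ^ 2 <= 2 ^ (2 * t))%N by rewrite leq_exp2l // leq_pmulr.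
  by lia.
have [s st] : exists s, (s = 6 * t)%N by exists (6 * t)%N.
(* 15 = 2 + 1 + 12: [light_bound] equals 2 q^10 + q^2 + 12 t, at most 15 q^11, against q^12 sets of
   pendant vertices. Also 12 t <= 15 q = d n bounds the pendant vertices. *)
pose d : R := 15 / q.
pose n : R := m.+3%:R.
have nq : n = q ^+ 2 by rewrite /n nE /q natrX -exprM mulnC.
have ME : (2 ^ (2 * s))%:R = q ^+ 12 :> R.
  by rewrite natrX /q -exprM; congr (_ ^+ _); rewrite st; lia.
have N_E : (m.+3 + 2 * s)%:R = n + 12 * t%:R :> R.
  by rewrite natrD st mulnA natrM.
have q0 : 0 < q by lra.
have qd : d * q = 15 by rewrite /d; field; lra.
have d0 : 0 <= d by rewrite divr_ge0 // ltW.
have lE : (light_bound m s)%:R <= d * q ^+ 12.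
  have sE : (2 ^ s)%:R = q ^+ 6 :> R by rewrite natrX /q -exprM st mulnC.
  rewrite /light_bound natrD N_E 2!natrM sE natrX -/n nq.
  rewrite (_ : 2 * _ * _ = 2 * q ^+ 10); last by ring.
  rewrite (_ : d * _ = 15 * q ^+ 11); last by rewrite -qd; ring.
  have e i j : (i <= j)%N -> q ^+ i <= q ^+ j by apply: ler_weXn2l; lra.
  have := e 10%N 11%N isT; have := e 2%N 11%N isT; have := e 1%N 11%N isT.
  by rewrite expr1; lra.
exists (broom m s), (v0 m s), (vmax m s); split => //.
  exact: connected_broom.
rewrite -/(closed_broom m s) /density !mean_subtree_orderE.
rewrite card_broom.
have [h [l [-> hM lb /andP[W1 W2]]]] := broom_order_sum m s.
have [l' [Q [-> lb' QE W1' W2']]] := closed_broom_order_sum m s.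
move: hM lb W1 W2 lb' QE W1' W2'.
have := card_gaps m; have := sum_gap_sizes m.
(* The sums become opaque numbers; only the (in)equalities between them are carried over to [R]. *)
move: (\sum_(p in gaps m) (p.2 - p.1))%N #|gaps m| => D P.
set W := (\sum_(S in subtrees (broom m s)) _)%N.
set W' := (\sum_(S in subtrees (closed_broom m s)) _)%N.
move: W W' => W W' /(congr1 (GRing.natmul (1 : R))) D6 /(congr1 (GRing.natmul (1 : R))) P2.

rewrite -!(ler_nat R) => hM lb W1 W2 lb' /(congr1 (GRing.natmul (1 : R))) QE W1' W2'.
have m2 : m.+2%:R = n - 1 by rewrite /n -[in RHS]natr1 addrK.
have m1 : m.+1%:R = n - 2 by rewrite -(addrK 1 m.+1%:R) natr1 m2; ring.
move: D6 P2 QE hM W1 W2 W1' W2'; rewrite !(ME, natrM, natrD) -/n m2 m1.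
have tn : 12 * t%:R <= d * n by rewrite nq expr2 mulrA qd; lra.
have nN : n <= n + 2 * s%:R by rewrite lerDl mulr_ge0 ?ler0n.
have sd : n + 2 * s%:R - n <= d * n by move: tn; rewrite st natrM; lra.
move=> D6 P2 QE hM W1 W2 W1' W2'.
have M0 : 0 < q ^+ 12 by apply: exprn_gt0.
have n3 : 3 <= n by rewrite ler_nat.
have dn : 1 <= d * n by rewrite nq expr2 mulrA qd; lra.
have ld k : k%:R <= (light_bound m s)%:R :> R -> k%:R <= d * q ^+ 12.
  by move=> kl; exact: le_trans kl lE.
have G1 : `|W%:R / (h%:R + l%:R) / (n + 2 * s%:R) - 1| <= 2 * d.
  apply: (@ratio_near_one _ n) => //; try lra.
  by rewrite (le_trans (ld _ lb)) // ler_wpM2l.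
have G2 : `|W'%:R / (q ^+ 12 * P%:R + l'%:R) / (n + 2 * s%:R) - 2 / 3| <= 3 * d.
  apply: (@ratio_near_two_thirds _ n _ _ Q%:R) => //; lra.
(* The errors [2 * d] and [3 * d] add up around 1 - 2/3 = 1/3. *)
have d_eps : 5 * d < eps.
  rewrite /d mulrA ltr_pdivrMr // -ltr_pdivrMl // mulrC; lra.
move: G1 G2; rewrite !ler_norml ltr_norml => /andP[? ?] /andP[? ?].
by apply/andP; split; lra.
Qed.
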